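(* Let $q$ be a power of a prime $p$, let $\xi\in\mathbb F_{q^2}\setminus\mathbb F_q$, and let $k$ be an integer with $0\le k\le q+1$. Then $$\widetilde{\mathcal B}_{W_k^{\mathrm{Luc}}}=\{\,T\subseteq U_{q+1}:\ |T|=k,\ e_a(T)=0\ \text{for all }a\in\{0,1,\dots,k\}\text{ with }a\not\le_p k\,\}.$$
   Context: For nonnegative integers $i,k$ with base-$p$ expansions $i=\sum_r i_rp^r$, $k=\sum_r k_rp^r$ ($0\le i_r,k_r\le p-1$), write $i\le_p k$ if $i_r\le k_r$ for all $r$. $\mathbb F_q[X,Y]_k$ is the space of homogeneous polynomials of degree $k$ over $\mathbb F_q$. The Lucas subspace is $W_k^{\mathrm{Luc}}=\mathrm{span}_{\mathbb F_q}\{X^{k-i}Y^i:0\le i\le k,\ i\le_p k\}\subseteq\mathbb F_q[X,Y]_k$. $\mathbb P^1(\mathbb F_q)=\mathbb F_q\cup\{\infty\}$. For a $k$-subset $S\subseteq\mathbb P^1(\mathbb F_q)$, $F_S(X,Y)=\prod_{t\in S}(X-tY)$, where the factor for $t=\infty$ is taken to be $Y$. For a subspace $W\subseteq\mathbb F_q[X,Y]_k$, $\mathcal B_W=\{S\subseteq\mathbb P^1(\mathbb F_q): |S|=k,\ F_S\in W\}$. $U_{q+1}=\{u\in\mathbb F_{q^2}^\times:u^{q+1}=1\}$. The Cayley transform is the bijection $\kappa:\mathbb P^1(\mathbb F_q)\to U_{q+1}$, $\kappa(x)=\frac{x-\xi}{x-\xi^q}$ for $x\in\mathbb F_q$, $\kappa(\infty)=1$,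 and $\widetilde{\mathcal B}_{W}=\{\kappa(S):S\in\mathcal B_{W}\}$. For a finite set $T$ of field elements, $e_a(T)$ is the $a$-th elementary symmetric polynomial of its elements ($e_0=1$). *)

(* Defs.v *)
From HB Require Import structures.
From mathcomp Require Import all_boot all_order all_algebra all_field.
From mathcomp.multinomials Require Export mpoly.

Set Implicit Arguments.
Unset Strict Implicit.
Unset Printing Implicit Defensive.

Import GRing.Theory.
Local Open Scope ring_scope.

Definition digit (p n r : nat) : nat := (n %/ p ^ r %% p)%N.

(* Digits of [i] beyond position [i] vanish when [1 < p], so a bounded
   quantifier suffices; see [lucas_leP]. *)
Definition lucas_le (p i k : nat) : bool :=
  [forall r : 'I_i.+1, digit p i r <= digit p k r]%N.

Lemma lucas_leP (p i k : nat) : (1 < p)%N ->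
  reflect (forall r, (digit p i r <= digit p k r)%N) (lucas_le p i k).
Proof.
move=> p_gt1; apply: (iffP forallP) => [le_ik r | le_ik r]; last exact: le_ik.
have [lt_ri | le_ir] := ltnP r i.+1; first exact: (le_ik (Ordinal lt_ri)).
rewrite /digit divn_small ?mod0n //.
exact: ltn_trans le_ir (ltn_expl _ p_gt1).
Qed.

Section Blocks.

Variables (F : finFieldType) (k : nat).

(* The projective line over [F] is [option F], with [None] as the point at
   infinity; [dhomog 2 F k] is the space of binary forms of degree [k]. *)

Definition varX : {mpoly F[2]} := 'X_(ord0 : 'I_2).
Definition varY : {mpoly F[2]} := 'X_(ord_max : 'I_2).

Definition point_form (t : option F) : {mpoly F[2]} :=
  if t is Some a then varX - a *: varY else varY.

Definition block_form (S : {set option F}) : {mpoly F[2]} :=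
  \prod_(t in S) point_form t.

Lemma varX_homog : varX \is 1.-homog.
Proof. by rewrite dhomogX /= mdeg1. Qed.

Lemma varY_homog : varY \is 1.-homog.
Proof. by rewrite dhomogX /= mdeg1. Qed.

Lemma block_form_homog (S : {set option F}) :
  block_form S \is #|S|.-homog.
Proof.
rewrite /block_form -sum1_card.
elim/big_rec2: _ => [|t d P _ homP]; first exact: dhomog1.
apply: dhomogM homP; case: t => [a|]; last exact: varY_homog.
by apply: rpredB; [exact: varX_homog | apply: rpredZ; exact: varY_homog].
Qed.

Lemma monomial_homog (i : nat) : (i <= k)%N ->
  varX ^+ (k - i) * varY ^+ i \is k.-homog.
Proof.
move=> le_ik; have := dhomogM (dhomogMn (k - i) varX_homog) (dhomogMn i varY_homog).
by rewrite !mul1n subnK.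
Qed.

(* ['dhomog_k P] is [P] as an element of the space of forms of degree [k], with
   value 0 when [P] is not homogeneous of degree [k]; by [monomial_homog] and
   [block_form_homog] this default is never reached below. *)

Definition lucas_space (p : nat) : {vspace dhomog 2 F k} :=
  <<[seq ['dhomog_k (varX ^+ (k - i) * varY ^+ i)]
       | i <- iota 0 k.+1 & lucas_le p i k]>>%VS.

Definition blocks (W : {vspace dhomog 2 F k}) : {set {set option F}} :=
  [set S : {set option F} | (#|S| == k) && (['dhomog_k (block_form S)] \in W)].

End Blocks.

Definition unit_circle (L : finFieldType) (q : nat) : {set L} :=
  [set u : L | (u != 0) && (u ^+ q.+1 == 1)].

(* [emb] is the inclusion of F_q in F_{q^2}. *)
Definition cayley (F L : finFieldType) (emb : {rmorphism F -> L}) (q : nat)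
    (xi : L) (t : option F) : L :=
  if t is Some x then (emb x - xi) / (emb x - xi ^+ q) else 1.

Definition cayley_blocks (F L : finFieldType) (emb : {rmorphism F -> L})
    (q : nat) (xi : L) (k : nat) (W : {vspace dhomog 2 F k}) : {set {set L}} :=
  [set cayley emb q xi @: S | S : {set option F} in blocks W].

Definition elem_sym (L : finFieldType) (T : {set L}) (a : nat) : L :=
  (mesym #|T| L a).@[fun j : 'I_#|T| => enum_val j].

(* Main.v *)
(* The Lucas space of degree k is the product of the p^r-th powers of the spaces
   of all forms of degree k_r, where the k_r are the digits of k; as raising to
   the power p is additive, it is stable under every linear substitution, over
   any field of characteristic p.  The Cayley transform is a projective
   transformation over F_{q^2}, so up to a nonzero scalar it turns F_S into the
   product of the X - u Y for u in T = kappa(S), whose coefficient at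
   X^(k-a) Y^a is (-1)^a e_a(T). *)

Require Import Defs.
From HB Require Import structures.
From mathcomp Require Import all_boot all_order all_algebra all_field.
From mathcomp Require Import ring.

Set Implicit Arguments.
Unset Strict Implicit.
Unset Printing Implicit Defensive.

Import GRing.Theory.
Local Open Scope ring_scope.

(** * Base-p digits and the absence of carries *)

Lemma lucas_le_div p i k : (1 < p)%N ->
  lucas_le p i k = (i %% p <= k %% p)%N && lucas_le p (i %/ p) (k %/ p).
Proof.
move=> p_gt1.
have digit0 a : digit p a 0 = (a %% p)%N by rewrite /digit expn0 divn1.
have digitS a r : digit p a r.+1 = digit p (a %/ p) r.
  by rewrite /digit expnS divnMA.
apply/(lucas_leP _ _ p_gt1)/andP=> [le_ik | [le0 /(lucas_leP _ _ p_gt1) leS]].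
  split; first by have := le_ik 0; rewrite !digit0.
  by apply/(lucas_leP _ _ p_gt1)=> r; rewrite -!digitS.
by case=> [|r]; rewrite ?digit0 ?digitS.
Qed.

(** A carry would make the lowest digit of the sum [i %% p + j %% p - p], which is smaller than
    [j %% p]. *)
Lemma modn_le_no_carry p i j : (0 < p)%N -> (j %% p <= (i + j) %% p)%N ->
  ((i + j) %% p = i %% p + j %% p)%N /\ ((i + j) %/ p = i %/ p + j %/ p)%N.
Proof.
move=> p_gt0; rewrite modnD // divnD //; case: (leqP p) => [le_p | _].
  rewrite mul1n leq_subRL // leq_add2r => le_pi.
  by have := ltn_pmod i p_gt0; rewrite ltnNge le_pi.
by rewrite mul0n subn0 addn0.
Qed.

(** * Stability of Lucas forms under linear substitutions *)

Section LucasForms.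

Variables (R : comNzRingType) (p : nat).
Hypothesis pcharRp : p \in [pchar R].

Let p_gt1 : (1 < p)%N. Proof. exact/prime_gt1/(pcharf_prime pcharRp). Qed.
Let p_gt0 : (0 < p)%N. Proof. exact: ltnW. Qed.

Definition lucas_mnm (k : nat) : pred 'X_{1..2} :=
  fun m => (mdeg m == k) && lucas_le p (m ord_max) k.

(** Membership in the Lucas space, phrased on supports so that it makes sense over any commutative
    ring and passes through field embeddings; [mem_lucas_space] gives the link. *)
Definition lucas_form (k : nat) (f : {mpoly R[2]}) : bool :=
  all (lucas_mnm k) (msupp f).

Lemma lucas_form_sum k (I : eqType) (r : seq I) (f : I -> {mpoly R[2]}) :
  {in r, forall i, lucas_form k (f i)} -> lucas_form k (\sum_(i <- r) f i).
Proof.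
move=> lucas_f; apply/allP=> m /msupp_sum_le /flatten_mapP[i].
by rewrite filter_predT => /lucas_f/allP; apply.
Qed.

Lemma lucas_formZ k c f : lucas_form k f -> lucas_form k (c *: f).
Proof. by move=> /allP lucas_f; apply/allP=> m /msuppZ_le/lucas_f. Qed.

Lemma leq_mdeg n (m : 'X_{1..n}) i : (m i <= mdeg m)%N.
Proof. by rewrite mdegE (bigD1 i) //= leq_addr. Qed.

(* In base p, g ^+ p shifts the digits of the exponents of g, and f supplies the
   lowest digit. *)
Lemma lucas_formM_pFrobenius d k f g :
    (d < p)%N -> f \is d.-homog -> lucas_form k g ->
  lucas_form (d + k * p) (f * g ^+ p).
Proof.
move=> d_lt_p /dhomogP homog_f /allP lucas_g.
have pchar_mpoly: p \in [pchar {mpoly R[2]}].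
  exact: (rmorph_pchar (@mpolyC 2 R)).
have ->: g ^+ p = \sum_(m <- msupp g) g@_m ^+ p *: 'X_[m *+ p].
  rewrite {1}[g]mpolyE -(pFrobenius_autE pchar_mpoly) rmorph_sum /=.
  by apply: eq_bigr => m _; rewrite pFrobenius_autE exprZn mpolyXn.
rewrite mulr_sumr; apply: lucas_form_sum => m /lucas_g /andP[/eqP deg_m le_mk].
rewrite -scalerAr; apply/lucas_formZ/allP => m0.
move=> /msuppM_le/allpairsP[[m1 m2] /= [f_m1]].
rewrite msuppX inE => /eqP-> ->; have deg_m1 : mdeg m1 = d by exact: homog_f.
apply/andP; split; first by rewrite mdegD mdegMn deg_m1 deg_m.
(* Since [d < p], adding [m1] to [m *+ p] causes no carry: the Y-exponent has lowest digit
   [m1 ord_max], followed by the digits of [m ord_max]. *)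
have m1_le_d : (m1 ord_max <= d)%N by rewrite -deg_m1 leq_mdeg.
have m1_lt_p := leq_ltn_trans m1_le_d d_lt_p.
rewrite mnmDE mulmnE lucas_le_div // ![(_ + _ * p)%N]addnC.
by rewrite !modnMDl !divnMDl // !modn_small // !divn_small // !addn0 m1_le_d.
Qed.

(** Strong induction on the degree, splitting off the lowest digits of [i] and [j]. As they add
    without carry, the split-off factor has degree [(i + j) %% p], and the rest is the p-th power of
    a product of the same shape in degree [(i + j) %/ p]. *)
Lemma lucas_form_exp2 (A B : {mpoly R[2]}) i j :
    A \is 1.-homog -> B \is 1.-homog -> lucas_le p j (i + j) ->
  lucas_form (i + j) (A ^+ i * B ^+ j).
Proof.
move=> homA homB; have [k] := ubnP (i + j); elim: k => // k IHk in i j *.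
rewrite ltnS lucas_le_div // => le_ijk.
case/andP=> /modn_le_no_carry[//|modE divE] le_div.
(* Division by [p] lowers the degree only when it is positive. *)
have [ij0 | ij_gt0] := posnP (i + j).
  have /eqP := ij0; rewrite addn_eq0 => /andP[/eqP-> /eqP->].
  rewrite mulr1 /lucas_form msupp1 /= andbT /lucas_mnm mdeg0 mnm0E addn0 /=.
  exact/lucas_leP.
rewrite [in lucas_form _](divn_eq (i + j) p) modE divE addnC.
have -> : A ^+ i * B ^+ j =
    (A ^+ (i %% p) * B ^+ (j %% p)) * (A ^+ (i %/ p) * B ^+ (j %/ p)) ^+ p.
  by rewrite exprMn -!exprM mulrACA -!exprD ![(_ %% p + _)%N]addnC -!divn_eq.
apply: lucas_formM_pFrobenius.
- by rewrite -modE ltn_pmod.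
- have := dhomogM (dhomogMn (i %% p) homA) (dhomogMn (j %% p) homB).
  by rewrite !mul1n.
- apply: IHk; last by rewrite -divE.
  by rewrite -divE (leq_trans _ le_ijk) // ltn_Pdiv.
Qed.

(** The substitution turns each monomial of [f] into a product of powers of two linear forms, to
    which [lucas_form_exp2] applies. *)
Lemma lucas_form_comp k (lq : 2.-tuple {mpoly R[2]}) f :
    (forall i, tnth lq i \is 1.-homog) -> lucas_form k f ->
  lucas_form k (f \mPo lq).
Proof.
move=> hom_lq /allP lucas_f; rewrite comp_mpolyE.
apply: lucas_form_sum => m /lucas_f /andP[].
rewrite mdegE !big_ord_recl big_ord0 addn0 big_ord0 mulr1 => /eqP <-.
rewrite -(_ : ord_max = lift ord0 ord0); last exact: val_inj.
by move=> le_m; apply/lucas_formZ/lucas_form_exp2.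
Qed.

End LucasForms.

Lemma lucas_form_scale (F : fieldType) p k (c : F) f : c != 0 ->
  lucas_form p k (c *: f) = lucas_form p k f.
Proof. by move=> c_neq0; apply/perm_all/msuppZ. Qed.

(** * Coefficients of binary forms, the Lucas space and elementary symmetric polynomials *)

Section BinaryForms.

Variable F : finFieldType.
Implicit Type m : 'X_{1..2}.

Lemma ord2P (P : 'I_2 -> Prop) : P ord0 -> P ord_max -> forall i, P i.
Proof.
move=> P0 P1 [[|[|//]] lti]; [move: P0 | move: P1];
  by congr P; apply: val_inj.
Qed.

Lemma big_ord2 (T : Type) (idx : T) (op : Monoid.law idx) (f : 'I_2 -> T) :
  \big[op/idx]_(i < 2) f i = op (f ord0) (f ord_max).
Proof.
rewrite !big_ord_recr big_ord0 /= Monoid.mul1m.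
by congr (op (f _) _); apply: val_inj.
Qed.

Lemma mpolyX_varXY m :
  'X_[m] = varX F ^+ m ord0 * varY F ^+ m ord_max.
Proof. by rewrite mpolyXE_id big_ord2. Qed.

Definition mnm_pair (a b : nat) : 'X_{1..2} :=
  (U_(ord0 : 'I_2) *+ a + U_(ord_max : 'I_2) *+ b)%MM.

Lemma mnm_pair0 a b : mnm_pair a b ord0 = a.
Proof. by rewrite mnmDE !mulmnE !mnm1E /= ?mul1n ?mul0n ?addn0. Qed.

Lemma mnm_pair1 a b : mnm_pair a b ord_max = b.
Proof. by rewrite mnmDE !mulmnE !mnm1E /= ?mul1n ?mul0n ?addn0. Qed.

Lemma mdeg_mnm_pair a b : mdeg (mnm_pair a b) = (a + b)%N.
Proof. by rewrite mdegE big_ord2 /= mnm_pair0 mnm_pair1. Qed.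

Lemma mcoeff_varXY a b m :
  (varX F ^+ a * varY F ^+ b)@_m = ((a == m ord0) && (b == m ord_max))%:R.
Proof.
rewrite !mpolyXn -mpolyXD -/(mnm_pair a b) mcoeffX.
congr (_%:R); congr nat_of_bool.
apply/eqP/andP=> [<- | [/eqP eq0 /eqP eq1]].
  by rewrite mnm_pair0 mnm_pair1 !eqxx.
by apply/mnmP; apply: ord2P; rewrite ?mnm_pair0 ?mnm_pair1.
Qed.

Lemma lucas_form_varXY p k i : (i <= k)%N -> lucas_le p i k ->
  lucas_form p k (varX F ^+ (k - i) * varY F ^+ i).
Proof.
move=> le_ik lucas_i; apply/allP=> m.
rewrite mcoeff_msupp mcoeff_varXY.
have [/andP[/eqP m0 /eqP m1] _ | _] := boolP (_ && _); last by rewrite eqxx.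
by rewrite /lucas_mnm mdegE big_ord2 /= -m0 -m1 subnK // eqxx.
Qed.

Lemma mem_lucas_space p k (f : {mpoly F[2]}) : f \is k.-homog ->
  (['dhomog_k f] \in lucas_space F k p) = lucas_form p k f.
Proof.
have indhomogK (g : {mpoly F[2]}) : g \is k.-homog ->
    mpoly_of_dhomog ['dhomog_k g] = g by exact: insubdK.
move=> homf; apply/idP/idP => [|/allP lucas_f].
  rewrite /lucas_space; set s := map _ _ => /(@coord_span _ _ _ (in_tuple s)).
  move/(congr1 (@mpoly_of_dhomog _ _ _)); rewrite indhomogK // => ->.
  rewrite raddf_sum; apply: lucas_form_sum => j _.
  apply: (@lucas_formZ _ _ _ (coord _ _ _) (s`_j : dhomog 2 F k)).
  have /mapP[i] : s`_j \in s by apply: mem_nth.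
  rewrite mem_filter mem_iota add0n ltnS => /and3P[le_i _ le_ik] ->.
  by rewrite indhomogK ?monomial_homog //; apply: lucas_form_varXY.
(* Conversely, [f] is the combination of its own monomials, each of which is a generator of the
   Lucas space. *)
have -> : ['dhomog_k f] = \sum_(m <- msupp f) f@_m *: ['dhomog_k 'X_[F, m]].
  apply: val_inj; rewrite /= indhomogK // raddf_sum [LHS]mpolyE /=.
  apply: eq_big_seq => m fm; rewrite -[RHS]/(_ *: mpoly_of_dhomog _).
  rewrite indhomogK // dhomogX.
  by apply/eqP; move/dhomogP: homf; apply.
rewrite big_seq; apply: rpred_sum => m /lucas_f /andP[/eqP deg_m le_m].
apply/rpredZ/memv_span; apply/mapP; exists (m ord_max).
  by rewrite mem_filter le_m mem_iota add0n ltnS -deg_m leq_mdeg.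
by rewrite mpolyX_varXY -deg_m mdegE big_ord2 /= addnK.
Qed.

(** Vieta's formula: expand the product over the sets [J] of factors that contribute their Y-term;
    the coefficient collects the [J] of size [m ord_max]. *)
Lemma mcoeff_prod_point_form (T : {set F}) m : mdeg m = #|T| ->
  (\prod_(u in T) point_form (Some u))@_m
    = (-1) ^+ m ord_max * elem_sym T (m ord_max).
Proof.
move=> deg_m; rewrite big_enum_val /=.
under eq_bigr do rewrite addrC.
rewrite bigA_distr raddf_sum /elem_sym /mesym rmorph_sum mulr_sumr /=.
rewrite [RHS]big_mkcond; apply: eq_bigr => J _ /=.
have -> : \prod_i (if i \in J then - (enum_val i *: varY F) else varX F) =
    ((-1) ^+ #|J| * \prod_(i in J) enum_val i)
      *: (varX F ^+ #|~: J| * varY F ^+ #|J|).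
  rewrite (bigID (mem J)) /= -prodrN scalerAr -!prodr_const -scaler_prod.
  rewrite mulrC; congr (_ * _); last by apply: eq_bigr => i ->; rewrite scaleNr.
  by apply: eq_big => [i | i /negbTE-> //]; rewrite inE.
rewrite mcoeffZ mcoeff_varXY.
(* The sizes of [J] and its complement add up to the degree, so the second equality forces the
   first. *)
have -> : (#|~: J| == m ord0) && (#|J| == m ord_max) = (#|J| == m ord_max).
  have cardJ : (#|J| + #|~: J| = m ord0 + m ord_max)%N.
    by rewrite cardsC card_ord -deg_m mdegE big_ord2.
  rewrite andb_idl // => /eqP Jm.
  by move: cardJ; rewrite -Jm addnC => /addIn/eqP.
case: eqP => [-> | _]; last by rewrite mulr0.
rewrite mulr1 rmorph_prod; congr (_ * _).
by apply: eq_bigr => i _; rewrite /= mevalXU.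
Qed.

Lemma lucas_form_prod_point_form p k (T : {set F}) : #|T| = k ->
  lucas_form p k (\prod_(u in T) point_form (Some u)) =
  [forall a : 'I_k.+1, ~~ lucas_le p a k ==> (elem_sym T a == 0)].
Proof.
move=> cardT; apply/allP/forallP => [lucas_T a | sym_T m T_m].
  apply/implyP=> not_le; pose m := mnm_pair (k - a) a.
  have m_a : m ord_max = a by exact: mnm_pair1.
  have deg_m : mdeg m = k by rewrite mdeg_mnm_pair subnK // -ltnS.
  have : m \notin msupp (\prod_(u in T) point_form (Some u)).
    by apply: contra not_le => /lucas_T /andP[]; rewrite m_a.
  rewrite -mcoeff_eq0 mcoeff_prod_point_form ?cardT // m_a.
  by rewrite mulf_eq0 signr_eq0.
have deg_m : mdeg m = k.
  have /dhomogP -> // : \prod_(u in T) point_form (Some u) \is k.-homog.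
  (* The product is the block form of the finite points [Some @: T], hence homogeneous. *)
  have := block_form_homog (Some @: T).
  rewrite card_imset ?cardT; last exact: Some_inj.
  by rewrite /block_form big_imset //= => u v _ _ [].
have le_m : (m ord_max < k.+1)%N by rewrite ltnS -deg_m leq_mdeg.
rewrite /lucas_mnm deg_m eqxx /=; move: T_m; apply: contraLR => not_le.
have /implyP/(_ not_le)/eqP /= := sym_T (Ordinal le_m).
rewrite -mcoeff_eq0 mcoeff_prod_point_form ?deg_m ?cardT // => ->.
by rewrite mulr0.
Qed.

End BinaryForms.

(** * The Cayley transform as a bijection and as a linear substitution *)

Section Cayley.

Variables (F L : finFieldType) (emb : {rmorphism F -> L}) (q : nat) (xi : L).
Hypotheses (cardF : #|F| = q) (cardL : #|L| = (q ^ 2)%N).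
Hypothesis q_pchar : [pchar L].-nat q.
Hypothesis xi_notin : forall x : F, emb x <> xi.

(** Evaluate [X^q - X], the product of the [X - x] over [x] in [F], at [xi]: no factor vanishes. *)
Lemma conj_neq : xi ^+ q != xi.
Proof.
rewrite -subr_eq0.
have /(congr1 (fun P => (map_poly emb P).[xi])) := finField_genPoly F.
rewrite cardF rmorphB rmorph_prod /= map_polyXn map_polyX !hornerE => ->.
rewrite horner_prod; apply/prodf_neq0 => x _.
rewrite rmorphB /= map_polyX map_polyC hornerXsubC subr_eq0.
by apply/eqP=> /esym; apply: xi_notin.
Qed.

Lemma emb_conj x : emb x ^+ q = emb x.
Proof. by rewrite -rmorphXn -cardF expf_card. Qed.

Lemma conjK : (xi ^+ q) ^+ q = xi.
Proof. by rewrite -exprM mulnn -cardL expf_card. Qed.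

Lemma conjB (a b : L) : (a - b) ^+ q = a ^+ q - b ^+ q.
Proof. by apply/esym/eqP; rewrite subr_eq -exprDn_pchar // subrK. Qed.

Lemma emb_neq_xi x : emb x - xi != 0.
Proof. by rewrite subr_eq0; apply/eqP/xi_notin. Qed.

Lemma emb_neq_conj x : emb x - xi ^+ q != 0.
Proof.
rewrite subr_eq0; apply/eqP => e; case: (xi_notin (x := x)).
by rewrite -conjK -e emb_conj.
Qed.

Lemma cayley_inj : injective (cayley emb q xi).
Proof.
have conj_sub : xi ^+ q - xi != 0 by rewrite subr_eq0 conj_neq.
have cayley_neq1 x : cayley emb q xi (Some x) <> 1.
  (* The value 1 at a finite point would make numerator and denominator equal, hence
     [xi = xi ^+ q]. *)
  move/(canRL (divfK (emb_neq_conj x)))/eqP; rewrite mul1r.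
  by rewrite (inj_eq (addrI _)) eqr_opp eq_sym (negPf conj_neq).
case=> [x|] [y|] // => [|/cayley_neq1 //|/esym/cayley_neq1 //].
move/eqP; rewrite /= eqr_div ?emb_neq_conj // -subr_eq0.
have -> : (emb x - xi) * (emb y - xi ^+ q) - (emb y - xi) * (emb x - xi ^+ q)
        = (emb y - emb x) * (xi ^+ q - xi) by ring.
rewrite mulf_eq0 (negPf conj_sub) orbF subr_eq0 => /eqP/fmorph_inj->.
by [].
Qed.

(** Raising to the power [q] swaps numerator and denominator, so it inverts the value. *)
Lemma cayley_unit_circle t : cayley emb q xi t \in unit_circle L q.
Proof.
rewrite inE; case: t => [x|] /=; last by rewrite oner_eq0 expr1n eqxx.
rewrite mulf_neq0 ?invr_eq0 ?emb_neq_xi ?emb_neq_conj //=.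
rewrite exprS expr_div_n !conjB emb_conj conjK.
rewrite mulf_div [X in X / _]mulrC divff //.
by rewrite mulf_neq0 ?emb_neq_xi ?emb_neq_conj.
Qed.

(** By counting: the injective image has q + 1 elements, and there are at most q + 1 roots of unity
    of order dividing q + 1. *)
Lemma cayley_onto : cayley emb q xi @: setT = unit_circle L q.
Proof.
apply/eqP; rewrite eqEcard; apply/andP; split.
  by apply/subsetP=> _ /imsetP[t _ ->]; apply: cayley_unit_circle.
rewrite card_imset ?cardsT ?card_option ?cardF; last exact: cayley_inj.
rewrite cardE; apply: max_unity_roots; rewrite ?enum_uniq //.
apply/allP=> u; rewrite mem_enum inE => /andP[_ ?].
by rewrite unity_rootE.
Qed.

(* The first substitution sends X - t Y to (t - xi^q) X - (t - xi) Y; the second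
   inverts it up to the factor xi - xi^q. *)
Definition cayley_subst : 2.-tuple {mpoly L[2]} :=
  [tuple xi *: varY L - xi ^+ q *: varX L; varY L - varX L].

Definition cayley_inv_subst : 2.-tuple {mpoly L[2]} :=
  [tuple varX L - xi *: varY L; varX L - xi ^+ q *: varY L].

(** The scalar left over when [cayley_subst] acts on [point_form t]; at infinity it is -1 because Y
    becomes [Y - X]. *)
Definition cayley_factor (t : option F) : L :=
  if t is Some x then emb x - xi ^+ q else -1.

Lemma cayley_factor_neq0 t : cayley_factor t != 0.
Proof. by case: t => [x|] /=; rewrite ?emb_neq_conj ?oppr_eq0 ?oner_eq0. Qed.

Lemma map_varX : map_mpoly emb (varX F) = varX L.
Proof. exact: map_mpolyX. Qed.

Lemma map_varY : map_mpoly emb (varY F) = varY L.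
Proof. exact: map_mpolyX. Qed.

Lemma comp_varX (lq : 2.-tuple {mpoly L[2]}) : varX L \mPo lq = tnth lq ord0.
Proof. by rewrite comp_mpolyXU (tnth_nth 0). Qed.

Lemma comp_varY (lq : 2.-tuple {mpoly L[2]}) : varY L \mPo lq = tnth lq ord_max.
Proof. by rewrite comp_mpolyXU (tnth_nth 0). Qed.

Lemma point_form_cayley t :
  map_mpoly emb (point_form t) \mPo cayley_subst =
  cayley_factor t *: point_form (Some (cayley emb q xi t)).
Proof.
case: t => [x|] /=; last first.
  rewrite map_varY comp_varY !(tnth_nth 0) /=.
  by rewrite scale1r scalerBr !scaleN1r opprK addrC.
rewrite rmorphB /= map_mpolyZ map_varX map_varY.
rewrite raddfB /= comp_mpolyZ comp_varX comp_varY.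
rewrite !(tnth_nth 0) /= [RHS]scalerBr scalerA.
rewrite [_ * (_ / _)]mulrC divfK ?emb_neq_conj //.
rewrite -!mul_mpolyC !rmorphB /=.
ring.
Qed.

Lemma point_form_cayley_inv t :
  cayley_factor t *: (point_form (Some (cayley emb q xi t))
                        \mPo cayley_inv_subst) =
  (xi - xi ^+ q) *: map_mpoly emb (point_form t).
Proof.
rewrite /= raddfB /= comp_mpolyZ comp_varX comp_varY !(tnth_nth 0) /=.
rewrite [LHS]scalerBr scalerA.
case: t => [x|] /=; last first.
  rewrite map_varY mulr1 -!mul_mpolyC !rmorphB rmorphN rmorph1 /=.
  ring.
rewrite rmorphB /= map_mpolyZ map_varX map_varY.
rewrite [_ * (_ / _)]mulrC divfK ?emb_neq_conj //.
rewrite -!mul_mpolyC !rmorphB /=.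
ring.
Qed.

(** Each substitution carries one product to a nonzero multiple of the other, and both preserve
    Lucas forms. *)
Lemma lucas_form_block_form p k (S : {set option F}) : p \in [pchar L] ->
  lucas_form p k (block_form S) =
  lucas_form p k (\prod_(u in cayley emb q xi @: S) point_form (Some u)).
Proof.
move=> pcharLp; rewrite big_imset /=; last by move=> s t _ _; apply: cayley_inj.
have homB (c : L) (A B : {mpoly L[2]}) :
    A \is 1.-homog -> B \is 1.-homog -> A - c *: B \is 1.-homog.
  by move=> homA homB; apply: rpredB => //; apply: rpredZ.
have homX := varX_homog L; have homY := varY_homog L.
pose c := \prod_(t in S) cayley_factor t.
have c_neq0 : c != 0 by apply/prodf_neq0 => t _; apply: cayley_factor_neq0.
have d_neq0 : xi - xi ^+ q != 0 by rewrite subr_eq0 eq_sym conj_neq.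
(* The embedding is injective, so it leaves the support unchanged. *)
have <- : lucas_form p k (map_mpoly emb (block_form S))
        = lucas_form p k (block_form S).
  by apply/perm_all/msupp_map_mpoly/fmorph_inj.
apply/idP/idP => [lucas_S | lucas_T].
  rewrite -(lucas_form_scale _ _ _ c_neq0).
  rewrite -scaler_prod -(eq_bigr _ (fun t _ => point_form_cayley t)).
  rewrite -!rmorph_prod; apply: lucas_form_comp lucas_S => //.
  apply: ord2P; rewrite (tnth_nth 0) /=; last exact: rpredB.
  by apply: homB => //; apply: rpredZ.
(* Every point of [S] contributes one factor [xi - xi ^+ q] under the inverse substitution. *)
rewrite -(lucas_form_scale _ _ _ (expf_neq0 #|S| d_neq0)).
rewrite -prodr_const rmorph_prod -scaler_prod.
rewrite -(eq_bigr _ (fun t _ => point_form_cayley_inv t)).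
rewrite scaler_prod lucas_form_scale //.
rewrite -rmorph_prod; apply: lucas_form_comp lucas_T => //.
by apply: ord2P; rewrite (tnth_nth 0); apply: homB.
Qed.

End Cayley.

(** * Identification of the transformed Lucas blocks *)

Theorem theorem2 (p n q : nat) (p_prime : prime p) (n_gt0 : (0 < n)%N)
    (q_def : q = (p ^ n)%N)
    (F L : finFieldType) (cardF : #|F| = q) (cardL : #|L| = (q ^ 2)%N)
    (emb : {rmorphism F -> L})
    (xi : L) (xi_notin : forall x : F, emb x <> xi)
    (k : nat) (k_le : (k <= q.+1)%N) :
  cayley_blocks emb q xi (lucas_space F k p) =
  [set T : {set L} | [&& T \subset unit_circle L q, #|T| == k &
     [forall a : 'I_k.+1, ~~ lucas_le p a k ==> (elem_sym T a == 0)]]].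
Proof.
have pcharL : p \in [pchar L].
  by apply: (card_finPcharP (n := n * 2)) => //; rewrite cardL q_def expnM.
have q_pchar : [pchar L].-nat q by rewrite q_def pnatX pnatE ?pcharL.
have inj_cayley := cayley_inj cardF cardL xi_notin.
have mem_blocks (S : {set option F}) : (S \in blocks (lucas_space F k p)) =
    (#|cayley emb q xi @: S| == k) &&
    [forall a : 'I_k.+1, ~~ lucas_le p a k ==>
       (elem_sym (cayley emb q xi @: S) a == 0)].
  rewrite inE card_imset //; have [cardS | //] := eqVneq.
  rewrite mem_lucas_space -?cardS ?block_form_homog // cardS.
  rewrite (lucas_form_block_form cardF cardL xi_notin) //.
  by rewrite lucas_form_prod_point_form ?card_imset.
have onto_cayley := cayley_onto cardF cardL q_pchar xi_notin.
apply/setP=> T; rewrite inE; apply/imsetP/andP=> [[S] | [T_circle T_sym]].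
  rewrite mem_blocks => /andP[cardT symT] ->; rewrite cardT symT.
  by rewrite -onto_cayley imsetS ?subsetT.
(* As the transform is onto the unit circle, [T] is the image of its preimage, which serves as the
   block. *)
have imT : cayley emb q xi @: (cayley emb q xi @^-1: T) = T.
  apply/setP=> u; apply/imsetP/idP=> [[t] | Tu]; first by rewrite inE => Tt ->.
  have := subsetP T_circle u Tu; rewrite -onto_cayley => /imsetP[t _ def_u].
  by exists t; rewrite // inE -def_u.
exists (cayley emb q xi @^-1: T); last by rewrite imT.
by rewrite mem_blocks imT.
Qed.
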